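(* Let $\Phi : J_q(E)\to F_0$ be a bundle map with kernel $R_q$. For every $r\geq 0$ there exists a short exact sequence $$0\to H(R_{q+r})\to H(S_{r+1}(F_0))\to H(J_{r+1}(F_0))\to 0,$$ where $$H(R_{q+r})=R_{q+r}/\pi^{q+r+1}_{q+r}(R_{q+r+1}),$$ $$H(S_{r+1}(F_0))=\ker(\sigma_1(\Psi_r))/\mathrm{im}(\sigma_{r+1}(\Phi)),$$ $$H(J_{r+1}(F_0))=\ker(\rho_1(\Psi_r))/\mathrm{im}(\rho_{r+1}(\Phi)).$$
   Context: $X$ is a manifold of dimension $n$, with cotangent bundle $T^*$ and symmetric powers $S_kT^*$; $E$ and $F_0$ are vector bundles over $X$; $J_k(E)$ is the bundle of $k$-jets of sections of $E$, with canonical projections $\pi^{k+s}_{k}:J_{k+s}(E)\to J_k(E)$; the kernel of $\pi^{k+1}_k$ is $S_{k+1}T^*\otimes E$. One uses the canonical inclusions $J_{q+r}(E)\subset J_r(J_q(E))$ and $J_{r+1}(F_0)\subset J_1(J_r(F_0))$. Write $S_r(F_0)=S_rT^*\otimes F_0$. Given a vector bundle map $\Phi:J_q(E)\to F_0$ over $X$, set $R_q=\ker(\Phi)$. Its $r$-prolongation is the composite $\rho_r(\Phi): J_{q+r}(E)\hookrightarrow J_r(J_q(E))\xrightarrow{J_r(\Phi)} J_r(F_0)$ (with $\rho_0(\Phi)=\Phi$), and $R_{q+r}=\ker(\rho_r(\Phi))$. The induced symbol map is the restriction $\sigma_r(\Phi): S_{q+r}T^*\otimes E\to S_rT^*\otimes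 F_0$ of $\rho_r(\Phi)$. Set $Q_r=\mathrm{coker}(\rho_r(\Phi))$ with canonical projection $\Psi_r:J_r(F_0)\to Q_r$. The first prolongation of $\Psi_r$ is the composite $\rho_1(\Psi_r): J_{r+1}(F_0)\hookrightarrow J_1(J_r(F_0))\xrightarrow{J_1(\Psi_r)}J_1(Q_r)$, and $\sigma_1(\Psi_r): S_{r+1}T^*\otimes F_0\to T^*\otimes Q_r$ is the map induced by restricting $\rho_1(\Psi_r)$ to $S_{r+1}T^*\otimes F_0=\ker(J_{r+1}(F_0)\to J_r(F_0))$. Standing regularity assumption: $R_{q+r}$ and $R^{(s)}_{q+r}=\pi^{q+r+s}_{q+r}(R_{q+r+s})$ are vector bundles for all $r,s\geq 0$. *)

(* Defs.v *)
From HB Require Import structures.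
From mathcomp Require Import all_boot all_order all_algebra.
From mathcomp Require Import generic_quotient ring_quotient.
From mathcomp Require Import all_classical all_reals all_analysis.
Set Implicit Arguments.
Unset Strict Implicit.
Unset Printing Implicit Defensive.
Import Order.TTheory GRing.Theory Num.Theory.
Import numFieldNormedType.Exports.
Local Open Scope classical_set_scope.
Local Open Scope ring_scope.
Local Open Scope quotient_scope.

Section Linear.
Context {R : realType}.

Record subspace (V : lmodType R) := Subspace {
  subset_of :> V -> Prop;
  subspace0 : subset_of 0;
  subspace_lin : forall a u v,
    subset_of u -> subset_of v -> subset_of (a *: u + v) }.

Definition subpred (V : lmodType R) (S : subspace V) : V -> bool :=
  fun v => `[< S v >].

Section Subpred.
Variables (V : lmodType R) (S : subspace V).
Lemma subpredP v : reflect (S v) (v \in subpred S).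
Proof. exact: asboolP. Qed.
Lemma subpred_closed : submod_closed (subpred S).
Proof.
split=> [|a u v /subpredP Su /subpredP Sv]; apply/subpredP.
  exact: subspace0.
exact: subspace_lin.
Qed.
HB.instance Definition _ :=
  GRing.isSubmodClosed.Build R V (subpred S) subpred_closed.
Lemma subspaceD u v : S u -> S v -> S (u + v).
Proof. by move=> Su Sv; rewrite -(scale1r u); exact: subspace_lin. Qed.
Lemma subspaceZ a u : S u -> S (a *: u).
Proof.
by move=> Su; rewrite -(addr0 (_ *: _)); apply: subspace_lin => //; exact: subspace0.
Qed.
End Subpred.

Section Sub.
Variables (V : lmodType R) (S : subspace V).
Record sublmod := SubLmod { subval : V; subvalP : subval \in subpred S }.
HB.instance Definition _ := [isSub for subval].
HB.instance Definition _ := [Choice of sublmod by <:].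
HB.instance Definition _ := [SubChoice_isSubLmodule of sublmod by <:].
Lemma sublmodP (v : sublmod) : S (subval v).
Proof. by apply/subpredP; exact: subvalP. Qed.
Lemma subval_is_linear : linear subval. Proof. exact: (linearP (\val : sublmod -> V)). Qed.
HB.instance Definition _ :=
  GRing.isLinear.Build R sublmod V *:%R subval subval_is_linear.
End Sub.

Definition quotlmod (V : lmodType R) (W : subspace V) : Type :=
  Quotient.quot (GRing.ZmodClosed.clone V (subpred W) _).

Section Quot.
Variables (V : lmodType R) (W : subspace V).
HB.instance Definition _ := GRing.Zmodule.on (quotlmod W).
HB.instance Definition _ := Quotient.on (quotlmod W).

Definition qcoset (v : V) : quotlmod W := \pi_(quotlmod W) v.

Lemma qcoset_repr (c : quotlmod W) : qcoset (repr c) = c.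
Proof. exact: reprK. Qed.

Lemma qcoset_eqP v w : qcoset v = qcoset w <-> W (v - w).
Proof.
have E : (v - w \in subpred W) = (qcoset v == qcoset w).
  exact: Quotient.idealrBE.
by split=> [/eqP|/subpredP]; [rewrite -E => /subpredP|rewrite E => /eqP].
Qed.

Lemma qcosetD v w : qcoset (v + w) = qcoset v + qcoset w.
Proof. exact: raddfD. Qed.

Definition quot_scale (a : R) (c : quotlmod W) : quotlmod W :=
  qcoset (a *: repr c).

Lemma qcosetZ a v : qcoset (a *: v) = quot_scale a (qcoset v).
Proof.
apply/qcoset_eqP; rewrite -scalerBr; apply: subspaceZ.
by apply/qcoset_eqP; rewrite qcoset_repr.
Qed.

Let scaleA a b c : quot_scale a (quot_scale b c) = quot_scale (a * b) c.
Proof. by rewrite -(qcoset_repr c) -!qcosetZ scalerA. Qed.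
Let scale1 : left_id 1 quot_scale.
Proof. by move=> c; rewrite -(qcoset_repr c) -!qcosetZ scale1r. Qed.
Let scaleDr : right_distributive quot_scale +%R.
Proof.
move=> a c d; rewrite -(qcoset_repr c) -(qcoset_repr d).
by rewrite -qcosetD -!qcosetZ scalerDr qcosetD.
Qed.
Let scaleDl c : {morph quot_scale^~ c : a b / a + b}.
Proof.
by move=> a b; rewrite -(qcoset_repr c) -!qcosetZ scalerDl qcosetD.
Qed.

HB.instance Definition _ := GRing.Zmodule_isLmodule.Build R (quotlmod W)
  scaleA scale1 scaleDr scaleDl.

Lemma qcoset_is_linear : linear qcoset.
Proof. by move=> a v w; rewrite qcosetD qcosetZ. Qed.
HB.instance Definition _ :=
  GRing.isLinear.Build R V (quotlmod W) *:%R qcoset qcoset_is_linear.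

Lemma qcoset_eq0 v : qcoset v = 0 <-> W v.
Proof. by rewrite -(linear0 qcoset) qcoset_eqP subr0. Qed.
End Quot.

Definition linear_of (U V : lmodType R) (f : U -> V) (lin : linear f) :
  {linear U -> V} := HB.pack f (GRing.isLinear.Build R U V *:%R f lin).
End Linear.

Section Manifold.
Context {R : realType} {n : nat}.
Implicit Types (U : set 'rV[R]_n) (f g : 'rV[R]_n -> R).

(* f is of class C^k on the open set U: f and its iterated partial derivatives
   up to order k exist and are continuous on U. *)
Fixpoint Ck (k : nat) U f : Prop :=
  (forall x, U x -> {for x, continuous f}) /\
  if k is k'.+1 then
    forall j : 'I_n, let e := delta_mx 0 j in
      (forall x, U x -> derivable f x e) /\ Ck k' U (fun x => 'D_e f x)
  else True.

Definition Cinfty U f := forall k, Ck k U f.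

(* The values of coord outside dom, and of param outside the image of dom, are
   irrelevant. *)
Record chart (X : topologicalType) := Chart {
  dom : set X;
  coord : X -> 'rV[R]_n;
  param : 'rV[R]_n -> X;
  dom_open : open dom;
  img_open : open (coord @` dom);
  coordK : forall x, dom x -> param (coord x) = x;
  coord_continuous : forall x, dom x -> {for x, continuous coord};
  param_continuous : forall v, (coord @` dom) v -> {for v, continuous param} }.

Lemma CkW U U' k f : U' `<=` U -> Ck k U f -> Ck k U' f.
Proof.
move=> UU'; elim: k f => [|k IH] f [fc fd].
  by split=> // x /UU' /fc.
split=> [x /UU' /fc //|j]; have [d c] := fd j.
by split=> [x /UU' /d //|]; exact: IH.
Qed.

Lemma Ck_eq U k f g : open U -> (forall x, U x -> f x = g x) -> Ck k U f -> Ck k U g.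
Proof.
move=> Uo; have near_eq f' g' x : (forall x, U x -> f' x = g' x) -> U x ->
    \forall y \near x, f' y = g' y.
  by move=> fg Ux; near=> y; apply: fg; near: y; exact: open_nbhs_nbhs.
have cont f' g' : (forall x, U x -> f' x = g' x) ->
    (forall x, U x -> {for x, continuous f'}) ->
    forall x, U x -> {for x, continuous g'}.
  move=> fg fc x Ux; rewrite /prop_for /continuous_at -fg //.
  exact: cvg_trans (near_eq_cvg (near_eq _ _ x fg Ux)) (fc _ Ux).
elim: k f g => [|k IH] f g fg [fc fd]; (split; first exact: cont fc) => //= j.
have [d c] := fd j; split=> [x Ux|].
  exact: near_eq_derivable (near_eq _ _ _ fg Ux) (d _ Ux).
apply: IH c => x Ux; exact/near_eq_derive/near_eq.
Unshelve. all: by end_near. Qed.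

Lemma CkS U k f : Ck k.+1 U f -> Ck k U f.
Proof.
elim: k f => [|k IH] f [fc fd]; split=> // j.
by have [d c] := fd j; split=> //; exact: IH.
Qed.

Lemma Ck_cst U k (a : R) : Ck k U (cst a).
Proof.
elim: k a => [|k IH] a; (split; first by move=> x _; exact: cst_continuous) => // j.
split=> [x _|]; first exact: derivable_cst.
rewrite (_ : (fun x => _) = cst 0); first exact: IH.
by apply/funext => x; rewrite derive_cst.
Qed.

Lemma CkD U k f g : open U -> Ck k U f -> Ck k U g -> Ck k U (fun x => f x + g x).
Proof.
move=> Uo; elim: k f g => [|k IH] f g [fc fd] [gc gd];
  (split; first by move=> x Ux; apply: continuousD; [exact: fc|exact: gc]) => //= j.
have [df cf] := fd j; have [dg cg] := gd j; split=> [x Ux|].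
  by apply: derivableD; [exact: df|exact: dg].
apply: (Ck_eq Uo _ (IH _ _ cf cg)) => x Ux.
by rewrite -deriveD //; [exact: df|exact: dg].
Qed.

Lemma CkM U k f g : open U -> Ck k U f -> Ck k U g -> Ck k U (fun x => f x * g x).
Proof.
move=> Uo; elim: k f g => [|k IH] f g fk gk; have [fc fd] := fk; have [gc gd] := gk;
  (split; first by move=> x Ux; apply: continuousM; [exact: fc|exact: gc]) => //= j.
have [df cf] := fd j; have [dg cg] := gd j; split=> [x Ux|].
  by apply: derivableM; [exact: df|exact: dg].
apply: (Ck_eq Uo _ (CkD Uo (IH _ _ (CkS fk) cg) (IH _ _ (CkS gk) cf))) => x Ux.
by rewrite -[RHS]/('D__ (f * g) x) deriveM //; [exact: df|exact: dg].
Qed.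
End Manifold.

Arguments chart : clear implicits.

Record manifold (R : realType) (n : nat) := Manifold {
  point :> topologicalType;
  atlas : set (chart R n point);
  manifold_hausdorff : hausdorff_space point;
  manifold_countable : @second_countable point;
  atlas_cover : forall x, exists2 c, atlas c & dom c x;
  atlas_compat : forall c d, atlas c -> atlas d ->
    forall j, Cinfty (coord c @` (dom c `&` dom d))
                     (fun v => coord d (param c v) 0 j) }.

Section SmoothFun.
Context {R : realType} {n : nat} {M : manifold R n}.
Implicit Types (p : M) (f g : M -> R).

(* f is smooth on a neighbourhood of p; for a manifold it is equivalent to ask
   for smoothness in all the charts or in one chart around each point. *)
Definition smooth_fun_at p f :=
  exists U : set M, [/\ open U, U p &
    forall c, atlas c -> Cinfty (coord c @` (U `&` dom c)) (f \o param c)].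

Lemma coord_img_open (c : chart R n M) (U : set M) :
  open U -> open (coord c @` (U `&` dom c)).
Proof.
move=> Uo.
suff -> : coord c @` (U `&` dom c) = (coord c @` dom c) `&` (param c @^-1` U).
    rewrite openE => v [cv Uv]; apply: filterI.
    by apply: open_nbhs_nbhs; split=> //; exact: img_open.
  by apply: (param_continuous cv); exact/open_nbhs_nbhs.
apply/seteqP; split=> v.
  by move=> [x [Ux cx] <-]; split; [exists x|rewrite /= coordK].
by move=> [[x cx <-]]; rewrite /= coordK // => Ux; exists x.
Qed.

Lemma smooth_fun_near p f : smooth_fun_at p f -> \forall q \near p, smooth_fun_at q f.
Proof.
move=> [U [Uo Up fU]]; near=> q; exists U; split=> //.
by near: q; exact/open_nbhs_nbhs.
Unshelve. all: by end_near. Qed.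

Lemma smooth_fun2 (F : R -> R -> R) :
  (forall V k (f g : 'rV[R]_n -> R), open V -> Ck k V f -> Ck k V g -> Ck k V (fun x => F (f x) (g x))) ->
  forall p f g, smooth_fun_at p f -> smooth_fun_at p g -> smooth_fun_at p (fun q => F (f q) (g q)).
Proof.
move=> FC p f g [U [Uo Up fU]] [V [Vo Vp gV]].
exists (U `&` V); split=> //; first exact: openI.
move=> c ac k; apply: FC.
- by apply: coord_img_open; exact: openI.
- by apply: CkW (fU c ac k); apply: image_subset => x [[]].
- by apply: CkW (gV c ac k); apply: image_subset => x [[]].
Qed.

Lemma smooth_funD p f g : smooth_fun_at p f -> smooth_fun_at p g ->
  smooth_fun_at p (fun q => f q + g q).
Proof. by apply: smooth_fun2 => *; exact: CkD. Qed.

Lemma smooth_funM p f g : smooth_fun_at p f -> smooth_fun_at p g ->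
  smooth_fun_at p (fun q => f q * g q).
Proof. by apply: smooth_fun2 => *; exact: CkM. Qed.

Lemma smooth_fun_cst p (a : R) : smooth_fun_at p (cst a).
Proof. by exists setT; split=> //; [exact: openT|move=> c _ k; exact: Ck_cst]. Qed.

Lemma smooth_fun_eq p f g : smooth_fun_at p f -> (\forall q \near p, f q = g q) ->
  smooth_fun_at p g.
Proof.
move=> [U [Uo Up fU]]; rewrite /prop_near1 nbhsE => -[V [Vo Vp] fg].
exists (U `&` V); split=> //; first exact: openI.
move=> c ac k; apply: (Ck_eq (f := f \o param c)).
- by apply: coord_img_open; exact: openI.
- by move=> v [x [[Ux Vx] cx] <-] /=; rewrite coordK //; exact: fg.
- by apply: CkW (fU c ac k); apply: image_subset => x [[]].
Qed.
End SmoothFun.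

Section Family.
Context {R : realType} {n : nat} {M : manifold R n}.

Definition section (E : M -> lmodType R) := forall x, E x.

Section SectionLmod.
Variable E : M -> lmodType R.
Implicit Types s t u : section E.
HB.instance Definition _ := gen_eqMixin (section E).
HB.instance Definition _ := gen_choiceMixin (section E).
Let add s t : section E := fun x => s x + t x.
Let opp s : section E := fun x => - s x.
Let zero : section E := fun=> 0.
Let scale (a : R) s : section E := fun x => a *: s x.
Let ext s t : (forall x, s x = t x) -> s = t.
Proof. exact: functional_extensionality_dep. Qed.
Let addA : associative add. Proof. by move=> *; apply: ext => x; exact: addrA. Qed.
Let addC : commutative add. Proof. by move=> *; apply: ext => x; exact: addrC. Qed.
Let add0 : left_id zero add. Proof. by move=> *; apply: ext => x; exact: add0r. Qed.
Let addN : left_inverse zero opp add.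
Proof. by move=> *; apply: ext => x; exact: addNr. Qed.
HB.instance Definition _ := GRing.isZmodule.Build (section E) addA addC add0 addN.
Let scaleA a b s : scale a (scale b s) = scale (a * b) s.
Proof. by apply: ext => x; exact: scalerA. Qed.
Let scale1 : left_id 1 scale.
Proof. by move=> *; apply: ext => x; exact: scale1r. Qed.
Let scaleDr : right_distributive scale +%R.
Proof. by move=> *; apply: ext => x; exact: scalerDr. Qed.
Let scaleDl s : {morph scale^~ s : a b / a + b}.
Proof. by move=> *; apply: ext => x; exact: scalerDl. Qed.
HB.instance Definition _ := GRing.Zmodule_isLmodule.Build R (section E)
  scaleA scale1 scaleDr scaleDl.
End SectionLmod.

(* A family of vector spaces (E x)_x together with its sheaf of smooth sections,
   a sheaf of modules over the smooth functions: smooth_at p s means that s is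
   smooth on some neighbourhood of p (away from p, s is arbitrary). The sheaf is
   part of the data so that kernels, cokernels and quotients of bundle maps,
   whose rank need not be constant, make sense alongside vector bundles. *)
Record vfamily := VFamily {
  fiber :> M -> lmodType R;
  smooth_at : M -> section fiber -> Prop;
  smooth_near : forall p s, smooth_at p s -> \forall q \near p, smooth_at q s;
  smooth_eq : forall p s t,
    smooth_at p s -> (\forall q \near p, s q = t q) -> smooth_at p t;
  smooth0 : forall p, smooth_at p (fun=> 0);
  smoothD : forall p s t,
    smooth_at p s -> smooth_at p t -> smooth_at p (fun x => s x + t x);
  smoothZ : forall p f s,
    smooth_fun_at p f -> smooth_at p s -> smooth_at p (fun x => f x *: s x) }.

(* Local triviality of finite rank: around each point there is a smooth frame e,
   and the smooth sections are those with smooth coordinates in e. (A section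
   with smooth coordinates is smooth by smoothD, smoothZ and smooth_eq.) *)
Definition vector_bundle (E : vfamily) := forall p, exists m (e : 'I_m -> section E),
  [/\ forall i, smooth_at p (e i),
      \forall x \near p, forall v : E x,
        exists! a : 'rV[R]_m, v = \sum_i a 0 i *: e i x
    & forall s, smooth_at p s -> exists2 c : 'I_m -> M -> R,
        (forall i, smooth_fun_at p (c i)) &
        \forall x \near p, s x = \sum_i c i x *: e i x].

(* Smooth bundle maps over the identity of M, linear on the fibres. *)
Record bundle_map (E F : vfamily) := BundleMap {
  hom_fun :> forall x, {linear E x -> F x};
  hom_smooth : forall p s, smooth_at p s -> smooth_at p (fun x => hom_fun x (s x)) }.

Definition hom_comp (E F G : vfamily) (psi : bundle_map F G) (phi : bundle_map E F) : bundle_map E G :=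
  @BundleMap E G (fun x => psi x \o phi x) (fun p s ps => hom_smooth psi (hom_smooth phi ps)).

Definition linsub (E : vfamily) := forall x, subspace (E x).

Section SubQuot.
Variables (E : vfamily) (S W : linsub E).
Implicit Types p : M.

Let sub_smooth p (s : section (fun x => sublmod (S x))) :=
  smooth_at p (fun x => subval (s x)).
Let subn p s : sub_smooth p s -> \forall q \near p, sub_smooth q s.
Proof. exact: smooth_near. Qed.
Let sube p s t : sub_smooth p s -> (\forall q \near p, s q = t q) -> sub_smooth p t.
Proof.
move=> ps st; apply: (smooth_eq ps).
by apply: filterS st => x ->.
Qed.
Let sub0 p : sub_smooth p (fun=> 0).
Proof.
apply: (smooth_eq (smooth0 E p)); apply: nearW => x.
by rewrite (linear0 (@subval _ _ (S x))).
Qed.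
Let subD p s t : sub_smooth p s -> sub_smooth p t -> sub_smooth p (fun x => s x + t x).
Proof.
move=> ps pt; apply: (smooth_eq (smoothD ps pt)); apply: nearW => x.
by rewrite (linearD (@subval _ _ (S x))).
Qed.
Let subZ p f s : smooth_fun_at p f -> sub_smooth p s -> sub_smooth p (fun x => f x *: s x).
Proof.
move=> pf ps; apply: (smooth_eq (smoothZ pf ps)); apply: nearW => x.
by rewrite linearZ.
Qed.
Definition subfam : vfamily := VFamily subn sube sub0 subD subZ.

Let quot_smooth p (t : section (fun x => quotlmod (W x))) :=
  exists2 s : section E, smooth_at p s & \forall x \near p, t x = qcoset (W x) (s x).
Let quotn p t : quot_smooth p t -> \forall q \near p, quot_smooth q t.
Proof.
move=> [s ps ts]; near=> q; exists s; near: q; first exact: smooth_near.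
exact: near_join.
Unshelve. all: by end_near. Qed.
Let quote p s t : quot_smooth p s -> (\forall q \near p, s q = t q) -> quot_smooth p t.
Proof.
move=> [u pu su] st; exists u => //.
by apply: filterS2 su st => x -> ->.
Qed.
Let quot0 p : quot_smooth p (fun=> 0).
Proof.
exists (fun=> 0); first exact: smooth0.
by apply: nearW => x; rewrite linear0.
Qed.
Let quotD p s t : quot_smooth p s -> quot_smooth p t -> quot_smooth p (fun x => s x + t x).
Proof.
move=> [u pu su] [v pv tv]; exists (fun x => u x + v x); first exact: smoothD.
by apply: filterS2 su tv => x -> ->; rewrite linearD.
Qed.
Let quotZ p f s : smooth_fun_at p f -> quot_smooth p s -> quot_smooth p (fun x => f x *: s x).
Proof.
move=> pf [u pu su]; exists (fun x => f x *: u x); first exact: smoothZ.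
by apply: filterS su => x ->; rewrite linearZ.
Qed.
Definition quotfam : vfamily := VFamily quotn quote quot0 quotD quotZ.

Lemma proj_smooth p (s : section E) :
  smooth_at p s -> @smooth_at quotfam p (fun x => qcoset (W x) (s x)).
Proof. by move=> ps; exists s => //; exact: nearW. Qed.
Definition quot_proj : bundle_map E quotfam :=
  @BundleMap E quotfam (fun x => qcoset (W x)) proj_smooth.
End SubQuot.

Section Preim.
Variables (V W : lmodType R) (f : {linear V -> W}).
Lemma preim0 (S : subspace W) : S (f 0). Proof. by rewrite linear0; exact: subspace0. Qed.
Lemma preim_lin (S : subspace W) a u v : S (f u) -> S (f v) -> S (f (a *: u + v)).
Proof. by rewrite linearP; exact: subspace_lin. Qed.
Definition preim_sub (S : subspace W) : subspace V :=
  @Subspace _ V (fun v => S (f v)) (preim0 S) (@preim_lin S).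
Lemma ker_lin a u v : f u = 0 -> f v = 0 -> f (a *: u + v) = 0.
Proof. by rewrite linearP => -> ->; rewrite scaler0 addr0. Qed.
Definition ker_sub : subspace V :=
  @Subspace _ V (fun v => f v = 0) (linear0 f) ker_lin.
Lemma im0 (S : subspace V) : exists2 v, S v & f v = 0.
Proof. by exists 0; [exact: subspace0|exact: linear0]. Qed.
Lemma im_lin (S : subspace V) a w w' : (exists2 v, S v & f v = w) -> (exists2 v, S v & f v = w') ->
  exists2 v, S v & f v = a *: w + w'.
Proof.
move=> [v Sv <-] [v' Sv' <-]; exists (a *: v + v'); last by rewrite linearP.
exact: subspace_lin.
Qed.
Definition im_sub (S : subspace V) : subspace W :=
  @Subspace _ W (fun w => exists2 v, S v & f v = w) (im0 S) (@im_lin S).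
End Preim.

Definition full_sub (V : lmodType R) : subspace V :=
  @Subspace _ V (fun=> True) I (fun _ _ _ _ _ => I).

Definition ker (E F : vfamily) (phi : bundle_map E F) : linsub E := fun x => ker_sub (phi x).
Definition imS (E F : vfamily) (phi : bundle_map E F) (S : linsub E) : linsub F :=
  fun x => im_sub (phi x) (S x).
Definition im (E F : vfamily) (phi : bundle_map E F) : linsub F :=
  imS phi (fun x => full_sub (E x)).
(* The sections of a cokernel are locally images of smooth sections of F. *)
Definition coker (E F : vfamily) (phi : bundle_map E F) : vfamily := quotfam (im phi).
Definition coker_proj (E F : vfamily) (phi : bundle_map E F) : bundle_map F (coker phi) :=
  quot_proj (im phi).
(* S / (S :&: W), which is S / W when W is contained in S. *)
Definition subquot (E : vfamily) (S W : linsub E) : vfamily :=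
  @quotfam (subfam S) (fun x => preim_sub (@subval _ _ (S x)) (W x)).
End Family.

Arguments vfamily {R n} M.

Section Vanish.
Context {R : realType} {n : nat} {M : manifold R n}.
Implicit Types (E F : vfamily M) (x p : M) (f : M -> R).

(* The sections vanishing to order k at x: m_x^k . Gamma_x(E), where m_x is the
   ideal of the germs of smooth functions vanishing at x and Gamma_x(E) is the
   module of the germs at x of smooth sections of E. *)
Inductive vanish E x : nat -> section E -> Prop :=
| vanish_smooth s : smooth_at x s -> vanish x 0 s
| vanishD k s t : vanish x k s -> vanish x k t -> vanish x k (fun y => s y + t y)
| vanishM k f s : smooth_fun_at x f -> f x = 0 -> vanish x k s ->
    vanish x k.+1 (fun y => f y *: s y).

Variable E : vfamily M.
Implicit Types (s t : section E).

Lemma vanish_germ x k s : vanish x k s -> smooth_at x s.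
Proof.
elim=> [//|{}k {}s t _ xs _ xt|{}k f {}s xf _ _ xs]; first exact: smoothD.
exact: smoothZ.
Qed.

Lemma vanishZ x k f s : smooth_fun_at x f -> vanish x k s ->
  vanish x k (fun y => f y *: s y).
Proof.
move=> xf; elim=> [{}s xs|{}k {}s t _ xs _ xt|{}k g {}s xg g0 _ xs].
- by apply: vanish_smooth; exact: smoothZ.
- rewrite (_ : (fun y => _) = (fun y => f y *: s y + f y *: t y)).
    exact: vanishD.
  by apply: functional_extensionality_dep => y; rewrite scalerDr.
- rewrite (_ : (fun y => _) = (fun y => g y *: (f y *: s y))).
    exact: vanishM.
  by apply: functional_extensionality_dep => y; rewrite !scalerA mulrC.
Qed.

Lemma vanish_near0 x k s : (\forall y \near x, s y = 0) -> vanish x k s.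
Proof.
move=> s0; have xs : smooth_at x s.
  by apply: (smooth_eq (smooth0 E x)); apply: filterS s0 => y ->.
elim: k => [|k IH]; first exact: vanish_smooth.
pose f y : R := if `[< s y = 0 >] then 0 else 1.
rewrite (_ : s = (fun y => f y *: s y)).
  apply: vanishM => //.
    apply: (smooth_fun_eq (smooth_fun_cst x 0)).
    by apply: filterS s0 => y sy; rewrite /f; case: asboolP.
  by rewrite /f; case: asboolP => // /(_ (nbhs_singleton s0)).
apply: functional_extensionality_dep => y; rewrite /f.
by case: asboolP => [->|_]; rewrite ?scaler0 ?scale1r.
Qed.

Lemma vanish_eq x k s t :
  vanish x k s -> (\forall y \near x, s y = t y) -> vanish x k t.
Proof.
move=> ks st; rewrite (_ : t = (fun y => s y + (t y - s y))).
  apply: vanishD => //; apply: vanish_near0.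
  by apply: filterS st => y ->; rewrite subrr.
by apply: functional_extensionality_dep => y; rewrite addrC subrK.
Qed.

Lemma vanish0 x k : vanish x k (fun=> 0 : E _).
Proof. by apply: vanish_near0; exact: nearW. Qed.

Lemma vanishW x k l s : (k <= l)%N -> vanish x l s -> vanish x k s.
Proof.
move=> + ls; elim: ls k => [{}s xs|{}l {}s t _ IHs _ IHt|{}l f {}s xf f0 ls IH] k.
- by rewrite leqn0 => /eqP ->; exact: vanish_smooth.
- by move=> kl; apply: vanishD; [exact: IHs|exact: IHt].
- case: k => [_|k kl]; last by apply: vanishM => //; exact: IH.
  by apply: vanish_smooth; apply: smoothZ => //; exact: vanish_germ ls.
Qed.

Lemma vanish_at x k s : vanish x k.+1 s -> s x = 0.
Proof.
move En : k.+1 => m ms; elim: ms En => [//|{}m {}s t _ IHs _ IHt e|{}m f {}s _ f0 _ _ _].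
  by rewrite IHs // IHt // addr0.
by rewrite f0 scale0r.
Qed.

Lemma smoothB x s t : smooth_at x s -> smooth_at x t -> smooth_at x (fun y => s y - t y).
Proof.
move=> xs xt; apply: smoothD => //.
apply: (smooth_eq (smoothZ (smooth_fun_cst x (-1)) xt)).
by apply: nearW => y; rewrite scaleN1r.
Qed.

Lemma smooth_sum p m (s : 'I_m -> section E) : (forall i, smooth_at p (s i)) ->
  smooth_at p (fun x => \sum_i s i x).
Proof.
elim: m s => [|m IH] s ps.
  by apply: (smooth_eq (smooth0 E p)); apply: nearW => x; rewrite big_ord0.
have := smoothD (IH _ (fun i => ps (widen_ord (leqnSn m) i))) (ps ord_max).
by move/smooth_eq; apply; apply: nearW => x; rewrite big_ord_recr.
Qed.
End Vanish.

Lemma vanish_map (R : realType) (n : nat) (M : manifold R n) (E F : vfamily M)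
    (x : M) (phi : forall y, {linear E y -> F y}) k (s : section E) :
  (forall s, smooth_at x s -> smooth_at x (fun y => phi y (s y))) ->
  vanish x k s -> vanish x k (fun y => phi y (s y)).
Proof.
move=> phi_smooth; elim=> [{}s xs|{}k {}s t _ xs _ xt|{}k g {}s xg g0 _ xs].
- by apply: vanish_smooth; exact: phi_smooth.
- apply: (vanish_eq (vanishD xs xt)).
  by apply: nearW => y; rewrite linearD.
- apply: (vanish_eq (vanishM xg g0 xs)).
  by apply: nearW => y; rewrite linearZ.
Qed.

Section Jet.
Context {R : realType} {n : nat} {M : manifold R n}.
Variable E : vfamily M.
Implicit Types (x p : M) (f : M -> R) (s t : section E).

Lemma germ_lin x (a : R) s t :
  smooth_at x s -> smooth_at x t -> smooth_at x (a *: s + t).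
Proof. by move=> xs xt; apply/smoothD/xt/smoothZ/xs/smooth_fun_cst. Qed.
Definition germ x : subspace (section E) := Subspace (smooth0 E x) (@germ_lin x).

Lemma germ_vanish0 x k : vanish x k (subval (0 : sublmod (germ x))).
Proof. by rewrite linear0; exact: vanish0. Qed.
Lemma germ_vanish_lin x k (a : R) (s t : sublmod (germ x)) :
  vanish x k (subval s) -> vanish x k (subval t) -> vanish x k (subval (a *: s + t)).
Proof.
move=> xs xt; rewrite linearP; apply/vanishD/xt/vanishZ/xs.
exact: smooth_fun_cst.
Qed.
Definition germ_vanish x k : subspace (sublmod (germ x)) :=
  @Subspace _ (sublmod (germ x)) (fun s : sublmod (germ x) => vanish x k (subval s))
    (germ_vanish0 x k) (@germ_vanish_lin x k).

(* J_k(E)_x = Gamma_x(E) / m_x^{k+1} Gamma_x(E). In coordinates, by Taylor's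
   formula, two sections have the same k-jet at x when their partial derivatives
   of order at most k agree at x. Working with sections that are smooth near x
   instead of germs is harmless, since a section that is zero near x belongs to
   m_x^{k+1} Gamma_x(E) (lemma vanish_near0). *)
Definition jet_fib k x := quotlmod (germ_vanish x k.+1).
HB.instance Definition _ k x := GRing.Lmodule.on (jet_fib k x).

(* jet k s x is j_k(s)(x), and 0 when s is not smooth at x. *)
Definition germ_of x s : sublmod (germ x) := insubd 0 s.
Definition jet k s : section (jet_fib k) := fun x => qcoset _ (germ_of x s).

Lemma germ_ofK x s : smooth_at x s -> subval (germ_of x s) = s.
Proof. by move=> xs; exact: insubdK (introT (subpredP (germ x) s) xs). Qed.

Lemma jet_surj k x (c : jet_fib k x) : exists2 s, smooth_at x s & jet k s x = c.
Proof.
have xs : smooth_at x (subval (repr c)) := sublmodP (repr c).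
exists (subval (repr c)) => //.
by rewrite -[RHS]qcoset_repr; congr qcoset; apply: val_inj; exact: germ_ofK.
Qed.

Lemma jet_lin k x (a : R) s t : smooth_at x s -> smooth_at x t ->
  jet k (a *: s + t) x = a *: jet k s x + jet k t x.
Proof.
move=> xs xt; rewrite /jet -linearP; congr qcoset; apply: val_inj.
transitivity (a *: subval (germ_of x s) + subval (germ_of x t)).
  by rewrite !germ_ofK //; apply: germ_ofK; exact: germ_lin.
by symmetry; exact: (linearP (@subval _ _ (germ x))).
Qed.

Lemma jet_eq0 k x s : smooth_at x s -> jet k s x = 0 <-> vanish x k.+1 s.
Proof. by move=> xs; rewrite qcoset_eq0 /= germ_ofK. Qed.

Lemma jetB k x s t : smooth_at x s -> smooth_at x t ->
  jet k (fun y => s y - t y) x = jet k s x - jet k t x.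
Proof.
move=> xs xt; rewrite addrC -scaleN1r -jet_lin //; congr (jet k _ x);
  apply: functional_extensionality_dep => y.
by rewrite addrC -scaleN1r.
Qed.

Lemma jet_eqP k x s t : smooth_at x s -> smooth_at x t ->
  jet k s x = jet k t x <-> vanish x k.+1 (fun y => s y - t y).
Proof.
move=> xs xt; rewrite -jet_eq0 ?jetB //; last exact: smoothB.
by split=> [->|/eqP]; rewrite ?subrr // subr_eq0 => /eqP.
Qed.

Lemma jetD k x s t : smooth_at x s -> smooth_at x t ->
  jet k (fun y => s y + t y) x = jet k s x + jet k t x.
Proof.
move=> xs xt; rewrite -[jet k s x]scale1r -jet_lin //; congr (jet k _ x).
apply: functional_extensionality_dep => y.
by transitivity (1 *: s y + t y); rewrite ?scale1r.
Qed.

Lemma jet0Z x f s : smooth_fun_at x f -> smooth_at x s ->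
  jet 0 (fun y => f y *: s y) x = f x *: jet 0 s x.
Proof.
move=> xf xs; transitivity (jet 0 (f x *: s) x + jet 0 (fun y => (f y - f x) *: s y) x).
  have xcs : smooth_at x (f x *: s) by exact/(smoothZ _ xs)/smooth_fun_cst.
  rewrite -jetD //; last first.
    by apply: smoothZ => //; apply: smooth_funD => //; exact: smooth_fun_cst.
  congr (jet 0 _ x); apply: functional_extensionality_dep => y.
  by transitivity (f x *: s y + (f y - f x) *: s y) => //; rewrite -scalerDl addrC subrK.
have xd : smooth_fun_at x (fun y => f y - f x).
  by apply: smooth_funD => //; exact: smooth_fun_cst.
rewrite (jet_eq0 0 (smoothZ xd xs)).2 ?addr0; last first.
  by apply: vanishM => //; [rewrite subrr|exact: vanish_smooth].
have := jet_lin 0 (f x) xs (smooth0 E x).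
rewrite (jet_eq0 0 (smooth0 E x)).2 ?addr0 => [<-|]; last exact: vanish0.
by congr (jet 0 _ x).
Qed.

Lemma jet_near k x s t : smooth_at x s -> (\forall y \near x, s y = t y) ->
  jet k s x = jet k t x.
Proof.
move=> xs st; apply/jet_eqP => //; first exact: smooth_eq st.
by apply: vanish_near0; apply: filterS st => y ->; rewrite subrr.
Qed.

(* The smooth sections of J_k(E) are generated by the k-jets j_k(s) of the smooth
   sections s of E over the smooth functions. *)
Definition jet_smooth k p (t : section (jet_fib k)) :=
  exists m (f : 'I_m -> M -> R) (s : 'I_m -> section E),
    [/\ forall i, smooth_fun_at p (f i), forall i, smooth_at p (s i) &
        \forall x \near p, t x = \sum_i f i x *: jet k (s i) x].

Lemma jet_smooth_near k p (t : section (jet_fib k)) : jet_smooth p t -> \forall q \near p, jet_smooth q t.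
Proof.
move=> [m [f [s [pf ps ts]]]]; near=> q; exists m, f, s; split; last first.
- by near: q; exact: near_join.
- by near: q; apply: filter_forall => i; exact: smooth_near.
- by near: q; apply: filter_forall => i; exact: smooth_fun_near.
Unshelve. all: by end_near. Qed.

Lemma jet_smooth_eq k p (t u : section (jet_fib k)) :
  jet_smooth p t -> (\forall q \near p, t q = u q) -> jet_smooth p u.
Proof.
move=> [m [f [s [pf ps ts]]]] tu; exists m, f, s; split=> //.
by apply: filterS2 ts tu => x + <-.
Qed.

Lemma jet_smooth0 k p : jet_smooth p (fun x => 0 : jet_fib k x).
Proof.
exists 0%N, (fun=> cst 0), (fun=> fun=> 0); split=> [i|i|].
- exact: smooth_fun_cst.
- exact: smooth0.
- by apply: nearW => x; rewrite big_ord0.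
Qed.

Lemma jet_smoothD k p (t u : section (jet_fib k)) : jet_smooth p t -> jet_smooth p u ->
  jet_smooth p (fun x => t x + u x).
Proof.
move=> [m [f [s [pf ps ts]]]] [m' [f' [s' [pf' ps' us']]]].
exists (m + m')%N,
  (fun i => match fintype.split i with inl j => f j | inr j => f' j end),
  (fun i => match fintype.split i with inl j => s j | inr j => s' j end).
split=> [i|i|]; [by case: fintype.splitP|by case: fintype.splitP|].
apply: filterS2 ts us' => x -> ->; rewrite big_split_ord /=.
congr (_ + _); apply: eq_bigr => i _.
  by rewrite (unsplitK (inl i)).
by rewrite (unsplitK (inr i)).
Qed.

Lemma jet_smoothZ k p f (t : section (jet_fib k)) : smooth_fun_at p f -> jet_smooth p t ->
  jet_smooth p (fun x => f x *: t x).
Proof.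
move=> pf [m [g [s [pg ps ts]]]]; exists m, (fun i x => f x * g i x), s.
split=> [i|//|]; first exact: smooth_funM.
by apply: filterS ts => x ->; rewrite scaler_sumr; apply: eq_bigr => i _; rewrite scalerA.
Qed.

Definition Jet k : vfamily M := VFamily (@jet_smooth_near k) (@jet_smooth_eq k)
  (@jet_smooth0 k) (@jet_smoothD k) (@jet_smoothZ k).

Lemma smooth_jet k p s : smooth_at p s -> @smooth_at _ _ _ (Jet k) p (jet k s).
Proof.
move=> ps; exists 1%N, (fun=> cst 1), (fun=> s); split=> // [i|].
  exact: smooth_fun_cst.
by apply: nearW => x; rewrite big_ord1 scale1r.
Qed.

Section Lift.
Variables (k : nat) (x : M) (U : lmodType R) (g : section E -> U).
Hypothesis glin : forall (a : R) s t, smooth_at x s -> smooth_at x t ->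
  g (a *: s + t) = a *: g s + g t.
Hypothesis g0 : forall s, vanish x k.+1 s -> g s = 0.
Let lift (c : Jet k x) : U := g (subval (repr c)).

Let liftE s : smooth_at x s -> lift (jet k s x) = g s.
Proof.
move=> xs; rewrite /lift; set t := subval _.
have xt : smooth_at x t := sublmodP (repr (jet k s x)).
have e : jet k t x = jet k s x.
  rewrite /jet -[RHS]qcoset_repr; congr qcoset; apply: val_inj.
  exact: germ_ofK.
have := g0 ((jet_eqP k xt xs).1 e).
rewrite (_ : (fun y => _) = -1 *: s + t); last first.
  by apply: functional_extensionality_dep => y; rewrite addrC -scaleN1r.
by rewrite glin // scaleN1r addrC => /eqP; rewrite subr_eq0 => /eqP.
Qed.

Let lift_lin : linear lift.
Proof.
move=> a c d; have [s xs <-] := jet_surj c; have [t xt <-] := jet_surj d.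
by rewrite -jet_lin // !liftE ?glin //; exact: germ_lin.
Qed.

Definition jet_lift : {linear Jet k x -> U} := linear_of lift_lin.
Lemma jet_liftE s : smooth_at x s -> jet_lift (jet k s x) = g s.
Proof. exact: liftE. Qed.
End Lift.

Lemma jet_hom_smooth (F : vfamily M) k p (phi : forall x, {linear Jet k x -> F x}) :
  (forall s, smooth_at p s -> smooth_at p (fun x => phi x (jet k s x))) ->
  forall t : section (Jet k), smooth_at p t -> smooth_at p (fun x => phi x (t x)).
Proof.
move=> H t [m [f [s [pf ps ts]]]].
have : smooth_at p (fun x => \sum_i f i x *: phi x (jet k (s i) x)).
  by apply: smooth_sum => i; apply: smoothZ => //; exact: H.
move/smooth_eq; apply; apply: filterS ts => x ->.
by rewrite linear_sum; apply: eq_bigr => i _; rewrite linearZ.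
Qed.
End Jet.

Section JetMaps.
Context {R : realType} {n : nat} {M : manifold R n}.
Implicit Types (E F : vfamily M) (x p : M) (f : M -> R).

(* pi^l_k : J_l(E) -> J_k(E), j_l(s)(x) |-> j_k(s)(x). *)
Section Pi.
Variables (E : vfamily M) (k l : nat) (kl : (k <= l)%N).
Lemma pi_lin x (a : R) (s t : section E) : smooth_at x s -> smooth_at x t ->
  jet k (a *: s + t) x = a *: jet k s x + jet k t x.
Proof. exact: jet_lin. Qed.
Lemma pi_van x (s : section E) : vanish x l.+1 s -> jet k s x = 0.
Proof. by move=> ls; apply/jet_eq0; [exact: vanish_germ ls|exact: vanishW ls]. Qed.
Definition pi_fun x : {linear Jet E l x -> Jet E k x} := jet_lift (@pi_lin x) (@pi_van x).
Lemma pi_smooth p (t : section (Jet E l)) : smooth_at p t -> smooth_at p (fun x => pi_fun x (t x)).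
Proof.
apply: jet_hom_smooth => s ps; apply: (smooth_eq (smooth_jet k ps)).
by apply: filterS (smooth_near ps) => x xs; rewrite jet_liftE.
Qed.
Definition jet_pi : bundle_map (Jet E l) (Jet E k) := BundleMap pi_smooth.
Lemma jet_piE x (s : section E) : smooth_at x s -> jet_pi x (jet l s x) = jet k s x.
Proof. exact: jet_liftE. Qed.
End Pi.

(* J_k(phi) : J_k(E) -> J_k(F), j_k(s)(x) |-> j_k(phi s)(x). *)
Section Map.
Variables (E F : vfamily M) (phi : bundle_map E F) (k : nat).
Local Notation push s := (fun y => phi y (s y)).
Lemma map_lin x (a : R) (s t : section E) : smooth_at x s -> smooth_at x t ->
  jet k (push (a *: s + t)) x = a *: jet k (push s) x + jet k (push t) x.
Proof.
move=> xs xt; rewrite -jet_lin; [|exact: hom_smooth|exact: hom_smooth].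
congr (jet k _ x); apply: functional_extensionality_dep => y; exact: linearP.
Qed.
Lemma map_van x (s : section E) : vanish x k.+1 s -> jet k (push s) x = 0.
Proof.
move=> ls; apply/jet_eq0; first exact: (hom_smooth phi (vanish_germ ls)).
by apply: vanish_map ls => t; exact: hom_smooth.
Qed.
Definition map_fun x : {linear Jet E k x -> Jet F k x} := jet_lift (@map_lin x) (@map_van x).
Lemma map_smooth p (t : section (Jet E k)) :
  smooth_at p t -> smooth_at p (fun x => map_fun x (t x)).
Proof.
apply: jet_hom_smooth => s ps.
apply: (smooth_eq (smooth_jet k (hom_smooth phi ps))).
by apply: filterS (smooth_near ps) => x xs; rewrite jet_liftE.
Qed.
Definition jet_map : bundle_map (Jet E k) (Jet F k) := BundleMap map_smooth.
Lemma jet_mapE x (s : section E) : smooth_at x s -> jet_map x (jet k s x) = jet k (push s) x.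
Proof. exact: jet_liftE. Qed.
End Map.

(* J_k(E)_x -> J_{k+1}(E)_x, j_k(s)(x) |-> j_{k+1}((f - f(x)) s)(x); an auxiliary
   map for the well-definedness of the inclusion J_{r+q}(E) -> J_r(J_q(E)). *)
Section Mul.
Variables (E : vfamily M) (f : M -> R) (k : nat).
Let dev x : M -> R := if `[< smooth_fun_at x f >] then (fun y => f y - f x) else cst 0.
Let dev_smooth x : smooth_fun_at x (dev x).
Proof.
rewrite /dev; case: asboolP => [xf|_]; last exact: smooth_fun_cst.
by apply: smooth_funD => //; exact: smooth_fun_cst.
Qed.
Let dev0 x : dev x x = 0.
Proof. by rewrite /dev; case: asboolP => // _; rewrite subrr. Qed.
Local Notation mul x s := (fun y => dev x y *: s y).
Let mul_lin x (a : R) (s t : section E) : smooth_at x s -> smooth_at x t ->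
  jet k.+1 (mul x (a *: s + t)) x = a *: jet k.+1 (mul x s) x + jet k.+1 (mul x t) x.
Proof.
move=> xs xt; rewrite -jet_lin; [|exact: smoothZ|exact: smoothZ].
congr (jet _ _ x); apply: functional_extensionality_dep => y.
have e b (v w : E y) : b *: (a *: v + w) = a *: (b *: v) + b *: w.
  by rewrite scalerDr !scalerA mulrC.
exact: e.
Qed.
Let mul_van x (s : section E) : vanish x k.+1 s -> jet k.+1 (mul x s) x = 0.
Proof.
move=> ls; apply/jet_eq0; first exact: (smoothZ _ (vanish_germ ls)).
exact: vanishM.
Qed.
Definition jet_mul x : {linear Jet E k x -> Jet E k.+1 x} :=
  jet_lift (@mul_lin x) (@mul_van x).
Lemma jet_mulE x (s : section E) : smooth_fun_at x f -> smooth_at x s ->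
  jet_mul x (jet k s x) = jet k.+1 (fun y => f y *: s y) x - f x *: jet k.+1 s x.
Proof.
move=> xf xs; rewrite [LHS]jet_liftE // addrC -scaleNr -jet_lin //; last exact: smoothZ.
congr (jet _ _ x); apply: functional_extensionality_dep => y.
rewrite /dev; case: asboolP => // _.
by rewrite scalerBl addrC -scaleNr.
Qed.
Lemma jet_mul_smooth p (t : section (Jet E k)) : smooth_fun_at p f ->
  smooth_at p t -> smooth_at p (fun x => jet_mul x (t x)).
Proof.
move=> pf; apply: jet_hom_smooth => s ps.
have pj := smoothB (smooth_jet k.+1 (smoothZ pf ps)) (smoothZ pf (smooth_jet k.+1 ps)).
apply: (smooth_eq pj).
by apply: filterS2 (smooth_near ps) (smooth_fun_near pf) => x xs xf; rewrite jet_mulE.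
Qed.
End Mul.

Lemma vanish_jet E q N x (s : section E) :
  vanish x N s -> @vanish _ _ _ (Jet E q) x (N - q) (jet q s).
Proof.
move=> Ns; elim: Ns q => [{}s xs|{}N {}s t Ns IHs Nt IHt|{}N f {}s xf f0 Ns IH] q.
- by rewrite sub0n; apply/vanish_smooth/smooth_jet.
- apply: (vanish_eq (vanishD (IHs q) (IHt q))).
  apply: filterS2 (smooth_near (vanish_germ Ns)) (smooth_near (vanish_germ Nt)) => y ys yt.
  by rewrite jetD.
have near_s := smooth_near (vanish_germ Ns); have near_f := smooth_fun_near xf.
case: q => [|q].
  rewrite subn0; have := IH 0%N; rewrite subn0 => /(vanishM xf f0) /vanish_eq; apply.
  apply: filterS2 near_s near_f => y ys yf.
  by rewrite jet0Z.
have Nq : (N.+1 - q.+1 <= (N - q.+1).+1)%N by rewrite subSS subnS leqSpred.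
have := vanishD (vanishW Nq (vanishM xf f0 (IH q.+1)))
  (vanish_map (phi := @jet_mul E f q) (fun t xt => jet_mul_smooth xf xt) (IH q)).
move/vanish_eq; apply; apply: filterS2 near_s near_f => y ys yf.
by rewrite jet_mulE // addrC subrK.
Qed.

(* J_{r+q}(E) -> J_r(J_q(E)), j_{r+q}(s)(x) |-> j_r(j_q(s))(x). *)
Section Incl.
Variables (r q : nat) (E : vfamily M).
Local Notation jj s := (jet r (E := Jet E q) (jet q s)).
Let incl_lin x (a : R) (s t : section E) : smooth_at x s -> smooth_at x t ->
  jj (a *: s + t) x = a *: jj s x + jj t x.
Proof.
move=> xs xt; rewrite -jet_lin; [|exact: smooth_jet|exact: smooth_jet].
apply: jet_near; first exact/smooth_jet/germ_lin.
apply: filterS2 (smooth_near xs) (smooth_near xt) => y ys yt.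
exact: jet_lin.
Qed.
Let incl_van x (s : section E) : vanish x (r + q).+1 s -> jj s x = 0.
Proof.
move=> /[dup] /vanish_germ xs /(vanish_jet q).
by rewrite -addSn addnK => ls; apply/jet_eq0 => //; exact: smooth_jet.
Qed.
Let incl_fun x : {linear Jet E (r + q) x -> Jet (Jet E q) r x} :=
  jet_lift (@incl_lin x) (@incl_van x).
Let inclE x (s : section E) : smooth_at x s -> incl_fun x (jet (r + q) s x) = jj s x.
Proof. exact: jet_liftE. Qed.
Let incl_smooth p (t : section (Jet E (r + q))) :
  smooth_at p t -> smooth_at p (fun x => incl_fun x (t x)).
Proof.
apply: jet_hom_smooth => s ps.
apply: (smooth_eq (smooth_jet r (smooth_jet q ps))).
by apply: filterS (smooth_near ps) => x xs; rewrite inclE.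
Qed.
Definition jet_incl : bundle_map (Jet E (r + q)) (Jet (Jet E q) r) := BundleMap incl_smooth.
Lemma jet_inclE x (s : section E) : smooth_at x s -> jet_incl x (jet (r + q) s x) = jj s x.
Proof. exact: inclE. Qed.
End Incl.

Section Prolongation.
Variables (q : nat) (E F : vfamily M) (Phi : bundle_map (Jet E q) F).

(* rho_r(Phi). Orders are written r + q rather than q + r so that r.+1 + q and
   (r + q).+1 are convertible. *)
Definition prolong r : bundle_map (Jet E (r + q)) (Jet F r) :=
  hom_comp (jet_map Phi r) (jet_incl r q E).

Lemma prolongE r x (s : section E) : smooth_at x s ->
  prolong r x (jet (r + q) s x) = jet r (fun y => Phi y (jet q s y)) x.
Proof.
move=> xs; transitivity (jet_map Phi r x (jet_incl r q E x (jet (r + q) s x))) => //.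
by rewrite jet_inclE // jet_mapE //; exact: smooth_jet.
Qed.

Lemma prolong_pi r x (c : Jet E (r.+1 + q) x) :
  jet_pi F (leqnSn r) x (prolong r.+1 x c) =
  prolong r x (jet_pi E (leqnSn (r + q)) x c).
Proof.
have [s xs <-] := jet_surj c.
rewrite (jet_piE (leqnSn (r + q)) xs) !prolongE // jet_piE //.
exact/hom_smooth/smooth_jet.
Qed.
End Prolongation.
End JetMaps.

Section Complex.
Context {R : realType} {n : nat} {M : manifold R n}.

Lemma vanish_sum (E : vfamily M) x k m (s : 'I_m -> section E) :
  (forall i, vanish x k (s i)) -> vanish x k (fun y => \sum_i s i y).
Proof.
elim: m s => [|m IH] s xs.
  by apply: (vanish_eq (vanish0 E x k)); apply: nearW => y; rewrite big_ord0.
have := vanishD (IH _ (fun i => xs (widen_ord (leqnSn m) i))) (xs ord_max).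
by move/vanish_eq; apply; apply: nearW => y; rewrite big_ord_recr.
Qed.

Lemma jet0_eq0 (E : vfamily M) x (s : section E) :
  vector_bundle E -> smooth_at x s -> jet 0 s x = 0 <-> s x = 0.
Proof.
move=> vE xs; rewrite jet_eq0 //; split=> [|sx0]; first exact: vanish_at.
have [m [e [xe basis /(_ s xs) [c xc sE]]]] := vE x.
have [a [_ a_uniq]] := nbhs_singleton basis 0.
have c0 i : c i x = 0.
  have cs : 0 = \sum_i (\row_i c i x) 0 i *: e i x.
    rewrite -[LHS]sx0; have /= -> := nbhs_singleton sE.
    by apply: eq_bigr => j _; rewrite mxE.
  have zs : 0 = \sum_i (0 : 'rV[R]_m) 0 i *: e i x.
    by rewrite big1 // => j _; rewrite mxE scale0r.
  by have /rowP/(_ i) := etrans (esym (a_uniq _ cs)) (a_uniq _ zs); rewrite !mxE.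
suff : vanish x 1 (fun y => \sum_i c i y *: e i y).
  by move/vanish_eq; apply; apply: filterS sE => y ->.
by apply: vanish_sum => i; apply: vanishM => //; exact: vanish_smooth.
Qed.

Section Restrict.
Variables (E F : vfamily M) (phi : bundle_map E F) (S : linsub E) (T : linsub F).
Hypothesis ST : forall x v, S x v -> T x (phi x v).

Let restr x (v : sublmod (S x)) : sublmod (T x) :=
  SubLmod (introT (subpredP _ _) (ST (sublmodP v))).
Let restr_lin x : linear (@restr x).
Proof.
move=> a u v; apply: val_inj.
transitivity (a *: phi x (subval u) + phi x (subval v)); last first.
  by symmetry; exact: (linearP (@subval _ _ (T x))).
rewrite -linearP; congr (phi x _); exact: (linearP (@subval _ _ (S x))).
Qed.
Let restr_smooth p (s : section (subfam S)) :
  smooth_at p s -> @smooth_at _ _ _ (subfam T) p (fun x => linear_of (@restr_lin x) (s x)).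
Proof. exact: (@hom_smooth _ _ _ _ _ phi p (fun x => subval (s x))). Qed.
Definition restrict : bundle_map (subfam S) (subfam T) := BundleMap restr_smooth.
Lemma restrictE x v : subval (restrict x v) = phi x (subval v).
Proof. by []. Qed.
End Restrict.

(* symT E k is S_{k+1}T^* (x) E, taken as the kernel of the projection
   J_{k+1}(E) -> J_k(E). *)
Definition symT (E : vfamily M) k : vfamily M :=
  subfam (ker (jet_pi E (leqnSn k))).

Section Symbol.
Variables (q : nat) (E F : vfamily M) (Phi : bundle_map (Jet E q) F).

Lemma prolong_sym r x v : ker (jet_pi E (leqnSn (r + q))) x v ->
  ker (jet_pi F (leqnSn r)) x (prolong Phi r.+1 x v).
Proof.
by move=> v0; apply: etrans (prolong_pi Phi v) _; rewrite [X in prolong _ _ _ X]v0 linear0.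
Qed.

(* sigma_{r+1}(Phi) : S_{q+r+1}T^* (x) E -> S_{r+1}T^* (x) F. *)
Definition symbol r : bundle_map (symT E (r + q)) (symT F r) := restrict (@prolong_sym r).

(* R_{q+r} and R^{(s)}_{q+r}, as families of subspaces of J_{q+r}(E). *)
Definition Rker r : linsub (Jet E (r + q)) := ker (prolong Phi r).
Definition Rproj r s : linsub (Jet E (r + q)) :=
  imS (jet_pi E (leq_add (leq_addl s r) (leqnn q))) (Rker (s + r)).

Definition Q r : vfamily M := coker (prolong Phi r).
Definition Psi r : bundle_map (Jet F r) (Q r) := coker_proj (prolong Phi r).

(* Under J_0(F) = F the map prolong Phi 0 is Phi, so Rker 0 is the kernel R_q
   of Phi. *)
Lemma Rker0 : vector_bundle F ->
  forall x (c : Jet E q x), Rker 0 x c <-> Phi x c = 0.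
Proof.
move=> vF x c; have [s xs <-] := jet_surj c.
have xPs : smooth_at x (fun y => Phi y (jet q s y)) by exact/hom_smooth/smooth_jet.
by rewrite -(jet0_eq0 vF xPs) -(prolongE Phi 0 xs).
Qed.

End Symbol.

Section Cohomology.
Variables (q : nat) (E F : vfamily M) (Phi : bundle_map (Jet E q) F).

(* The numbers 1 + r and r.+1 are convertible, and symbol (Psi Phi r) 0 is
   sigma_1(Psi_r). *)
Definition HR r : vfamily M := subquot (Rker Phi r) (Rproj Phi r 1).
Definition HS r : vfamily M :=
  subquot (ker (symbol (Psi Phi r) 0)) (im (symbol Phi r)).
Definition HJ r : vfamily M :=
  subquot (ker (prolong (Psi Phi r) 1)) (im (prolong Phi r.+1)).

Lemma Rproj1_sub r x c : Rproj Phi r 1 x c -> Rker Phi r x c.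
Proof.
move=> [d d0 <-]; have [s xs sd] := jet_surj d; move: d0; rewrite -{}sd => s0.
have e : prolong Phi r x (jet (r + q) s x) = 0.
  rewrite -(jet_piE (leqnSn (r + q)) xs); apply: etrans (esym (prolong_pi Phi _)) _.
  transitivity (jet_pi F (leqnSn r) x 0); last exact: linear0.
  by congr (jet_pi _ _ _ _); exact: s0.
by apply: etrans e; congr (prolong Phi r x _); exact: jet_piE.
Qed.

Lemma prolong_Psi0 r x c : prolong (Psi Phi r) 1 x (prolong Phi r.+1 x c) = 0.
Proof.
have [s xs <-] := jet_surj c; rewrite prolongE //.
have near_s := smooth_near xs.
have xt : smooth_at x (fun y => Phi y (jet q s y)) by exact/hom_smooth/smooth_jet.
rewrite (prolongE (Psi Phi r) 1 xt).
apply/jet_eq0; first exact/hom_smooth/smooth_jet.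
apply: vanish_near0; apply: filterS near_s => y ys; apply/qcoset_eq0.
by exists (jet (r + q) s y) => //; exact: prolongE.
Qed.

Lemma im_symbol_sub r x c :
  im (symbol Phi r) x c -> ker (symbol (Psi Phi r) 0) x c.
Proof. by move=> [d _ <-]; apply: val_inj; exact: prolong_Psi0. Qed.

Lemma im_prolong_sub r x c :
  im (prolong Phi r.+1) x c -> ker (prolong (Psi Phi r) 1) x c.
Proof. by move=> [d _ <-]; exact: prolong_Psi0. Qed.
End Cohomology.

Definition short_exact (A B C : vfamily M) (f : bundle_map A B) (g : bundle_map B C) :=
  forall x, [/\ injective (f x),
    forall b, g x b = 0 <-> exists a, f x a = b
    & forall c, exists b, g x b = c].
End Complex.

(* Main.v *)
From mathcomp Require Import all_boot all_algebra.
From mathcomp Require Import all_classical all_analysis.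
From mathcomp Require Import reals.
Require Import Defs.
Set Implicit Arguments.
Unset Strict Implicit.
Unset Printing Implicit Defensive.
Import GRing.Theory.
Local Open Scope classical_set_scope.
Local Open Scope ring_scope.

(** The sequence is the snake-lemma sequence of the commutative square
<<
         alpha
      A1 -----> A0            A1 = J_{q+r+1}(E),   A0 = J_{q+r}(E),
  rho1 |         | rho0
      B1 -----> B0            B1 = J_{r+1}(F0),    B0 = J_r(F0),
         beta
>>
    whose vertical maps are rho_{r+1}(Phi) and rho_r(Phi) and whose horizontal
    maps are the jet projections, together with the subspace
    Z = ker(rho_1(Psi_r)) of B1. The kernels of alpha and beta are the symbol
    spaces.

    A class in H(R_{q+r}) is represented by c in A0 with rho0 c = 0. Lift c to
    d in A1: then rho1 d is killed by beta, so it lies in the symbol space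
    S_{r+1}(F0), and it lies in Z because rho_1(Psi_r) rho_{r+1}(Phi) = 0.
    Another lift differs from d by an element of ker(alpha), so the class of
    rho1 d modulo im(sigma_{r+1}(Phi)) depends on c only; this is the first map.
    It vanishes exactly when d can be corrected by ker(alpha) so that rho1 d = 0,
    that is, when c lies in the projection of R_{q+r+1}. The second map is
    induced by the inclusion of the symbol space in B1. A symbol v in Z
    that becomes zero in H(J_{r+1}(F0)) is rho1 d for some d, and
    rho0 (alpha d) = beta v = 0, so the class of v is the image of that of alpha d.

    For surjectivity of the second map one needs that beta maps Z into the image
    of rho0: then any w in Z can be moved into ker(beta) by subtracting an
    element of im(rho1). This is [ker_prolong_Psi]: if the 1-jet at x of
    Psi_r (j_r(s)) vanishes, so does its value at x, which says that j_r(s)(x) is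
    in the image of rho_r(Phi).

    All of this takes place in one fibre. Smoothness of the first map holds
    because a smooth section of J_{q+r}(E) is locally a combination of sections
    j_{q+r}(s_i) with smooth coefficients, hence lifts to the same combination of
    the j_{q+r+1}(s_i) ([jet_pi_lift]). The algebra is in [snake_short_exact]. *)

(** * Maps out of a quotient *)

Section QuotientLift.
Context {R : realType}.
Variables (V U : lmodType R) (W : subspace V) (h : {linear V -> U}).
Hypothesis h0 : forall v, W v -> h v = 0.

Let lift (c : quotlmod W) : U := h (repr c).

Let liftE v : lift (qcoset W v) = h v.
Proof.
apply/eqP; rewrite -subr_eq0 -linearB; apply/eqP/h0.
by apply/qcoset_eqP; rewrite qcoset_repr.
Qed.

Let lift_lin : linear lift.
Proof.
move=> a c d; rewrite -(qcoset_repr c) -(qcoset_repr d) -linearP.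
by rewrite !liftE linearP.
Qed.

Definition quot_lift : {linear quotlmod W -> U} := linear_of lift_lin.

Lemma quot_liftE v : quot_lift (qcoset W v) = h v.
Proof. exact: liftE. Qed.
End QuotientLift.

Section BundleMaps.
Context {R : realType} {n : nat} {M : manifold R n}.

Section Descend.
Variables (E G : vfamily M) (W : linsub E) (phi : bundle_map E G).
Hypothesis phi0 : forall x v, W x v -> phi x v = 0.

Let desc x : {linear quotfam W x -> G x} := quot_lift (@phi0 x).

Let desc_smooth p (t : section (quotfam W)) :
  smooth_at p t -> smooth_at p (fun x => desc x (t x)).
Proof.
move=> [s ps ts]; apply: (smooth_eq (hom_smooth phi ps)).
by apply: filterS ts => x ->; rewrite /desc quot_liftE.
Qed.

Definition descend : bundle_map (quotfam W) G := BundleMap desc_smooth.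

Lemma descendE x v : descend x (qcoset (W x) v) = phi x v.
Proof. exact: quot_liftE. Qed.
End Descend.

(** * A snake lemma for families of vector spaces *)

Lemma subval_insubd (V : lmodType R) (S : subspace V) v :
  S v -> subval (insubd (0 : sublmod S) v) = v.
Proof. by move=> Sv; exact: insubdK (introT (subpredP S v) Sv). Qed.

Section Snake.
Variables (A1 A0 B1 B0 : vfamily M).
Variables (alpha : bundle_map A1 A0) (beta : bundle_map B1 B0).
Variables (rho1 : bundle_map A1 B1) (rho0 : bundle_map A0 B0).
Hypothesis comm : forall x d, beta x (rho1 x d) = rho0 x (alpha x d).
Hypothesis alpha_surj : forall x c, exists d, alpha x d = c.
(* Surjectivity on sections, which the connecting map needs to be smooth. *)
Hypothesis alpha_lift : forall p t, smooth_at p t -> exists2 t',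
  smooth_at p t' & \forall x \near p, alpha x (t' x) = t x.

Variables (Z : linsub B1).
Hypothesis rho1_Z : forall x d, Z x (rho1 x d).
Hypothesis Z_rho0 : forall x w, Z x w -> exists c, rho0 x c = beta x w.

Variables (P : linsub A0) (S T : linsub (subfam (ker beta))).
(* P, S and T are given by characterisations, so that any presentation of the
   subspaces alpha (ker rho1), Z within ker beta, and rho1 (ker alpha) fits. *)
Hypothesis PE : forall x c, P x c <-> exists2 d, rho1 x d = 0 & alpha x d = c.
Hypothesis SE : forall x (v : sublmod (ker beta x)), S x v <-> Z x (subval v).
Hypothesis TE : forall x (v : sublmod (ker beta x)),
  T x v <-> exists2 d, alpha x d = 0 & rho1 x d = subval v.

(* The default values 0 of insubd make this total in d, so that smoothness can be
   read off near a point from a section d that is a lift only near that point. *)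
Let cocycle x (d : A1 x) : sublmod (S x) :=
  insubd (0 : sublmod (S x)) (insubd (0 : sublmod (ker beta x)) (rho1 x d)).

Let cocycleE x (d : A1 x) : rho0 x (alpha x d) = 0 ->
  subval (subval (cocycle d)) = rho1 x d.
Proof.
move=> d0; have bd : ker beta x (rho1 x d) by rewrite /= comm.
by rewrite /cocycle !subval_insubd //; apply/SE; rewrite subval_insubd.
Qed.

(* The connecting map. The lift is chosen independently in each fibre; linearity
   and smoothness come from conn_funE, by which any other lift gives the same
   class. *)
Let conn_fun x (v : subfam (ker rho0) x) : subquot S T x :=
  qcoset _ (cocycle (sval (cid (alpha_surj (subval v))))).

Let conn_funE x (v : subfam (ker rho0) x) d : alpha x d = subval v ->
  conn_fun v = qcoset _ (cocycle d).
Proof.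
rewrite /conn_fun; case: cid => d' /= d'v dv.
have v0 : rho0 x (subval v) = 0 := sublmodP v.
apply/qcoset_eqP/TE; exists (d' - d); first by rewrite linearB /= d'v dv subrr.
by rewrite !linearB /= !cocycleE ?d'v ?dv.
Qed.

Let conn_lin x : linear (@conn_fun x).
Proof.
move=> a u v.
have [d du] := alpha_surj (subval u); have [e ev] := alpha_surj (subval v).
have u0 : rho0 x (subval u) = 0 := sublmodP u.
have v0 : rho0 x (subval v) = 0 := sublmodP v.
have de : alpha x (a *: d + e) = subval (a *: u + v) by rewrite !linearP du ev.
rewrite (conn_funE du) (conn_funE ev) (conn_funE de) -linearP.
congr qcoset; do 2 apply: val_inj.
rewrite -[LHS]/(subval (subval _)) -[RHS]/(subval (subval _)).
by rewrite !linearP /= !cocycleE ?linearP ?du ?ev ?u0 ?v0 ?scaler0 ?addr0.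
Qed.

Let conn_smooth p (t : section (subfam (ker rho0))) : smooth_at p t ->
  smooth_at p (fun x => linear_of (@conn_lin x) (t x)).
Proof.
move=> pt; have [t' pt' tt'] := alpha_lift pt.
exists (fun x => cocycle (t' x)); last first.
  by apply: filterS tt' => x /conn_funE.
apply: (smooth_eq (hom_smooth rho1 pt')); apply: filterS tt' => x tx.
by rewrite cocycleE // tx; exact: (sublmodP (t x)).
Qed.

Let conn : bundle_map (subfam (ker rho0)) (subquot S T) := BundleMap conn_smooth.

Let conn_eq0 x (v : subfam (ker rho0) x) : conn x v = 0 <-> P x (subval v).
Proof.
have [d dv] := alpha_surj (subval v).
have d0 : rho0 x (alpha x d) = 0 by rewrite dv; exact: (sublmodP v).
rewrite PE -[conn x v]/(conn_fun v) (conn_funE dv) qcoset_eq0 /= TE cocycleE //.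
split=> [[e e0 de]|[e e0 ev]].
  by exists (d - e); rewrite linearB /= ?de ?subrr // e0 subr0.
by exists (d - e); rewrite linearB /= ?e0 ?subr0 // ev dv subrr.
Qed.

Let incl_Z x (v : subfam S x) : Z x (subval (subval v)).
Proof. exact/SE/sublmodP. Qed.

Let incl_fun x (v : subfam S x) : subfam Z x :=
  SubLmod (introT (subpredP _ _) (incl_Z v)).

Let incl_lin x : linear (@incl_fun x).
Proof.
move=> a u v; apply: val_inj.
by rewrite -![LHS]/(subval (subval _)) -[RHS]/(subval _) !linearP.
Qed.

Let incl_smooth p (t : section (subfam S)) : smooth_at p t ->
  @smooth_at _ _ _ (subfam Z) p (fun x => linear_of (@incl_lin x) (t x)).
Proof. by []. Qed.

Let incl : bundle_map (subfam S) (subfam Z) := BundleMap incl_smooth.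

Let incl_class : bundle_map (subfam S) (subquot Z (im rho1)) :=
  hom_comp (quot_proj _) incl.

Let incl_class_eq0 x v :
  incl_class x v = 0 <-> exists d, rho1 x d = subval (subval v).
Proof.
rewrite [incl_class x v]/(qcoset _ (incl_fun v)) qcoset_eq0.
by split=> [[d _ dv]|[d dv]]; exists d.
Qed.

Let incl_class_T x v : T x (subval v) -> incl_class x v = 0.
Proof. by move=> /TE[d _ dv]; apply/incl_class_eq0; exists d. Qed.

(** Here f is induced by the connecting map and g by the inclusion of ker beta in
    B1; exactness follows by chasing lifts along alpha. *)
Lemma snake_short_exact :
  exists (f : bundle_map (subquot (ker rho0) P) (subquot S T))
    (g : bundle_map (subquot S T) (subquot Z (im rho1))), short_exact f g.
Proof.
have P0 x v : P x (subval v) -> conn x v = 0 by move/conn_eq0.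
pose f : bundle_map (subquot (ker rho0) P) (subquot S T) :=
  @descend (subfam (ker rho0)) _
      (fun x => preim_sub (@subval _ _ (ker rho0 x)) (P x)) conn P0.
pose g : bundle_map (subquot S T) (subquot Z (im rho1)) :=
  @descend (subfam S) _
      (fun x => preim_sub (@subval _ _ (S x)) (T x)) incl_class incl_class_T.
have fE x v d : alpha x d = subval v -> f x (qcoset _ v) = qcoset _ (cocycle d).
  by rewrite [f x _]descendE => /conn_funE.
have gE x v : g x (qcoset _ v) = incl_class x v by exact: descendE.
exists f, g => x; split.
- move=> a b; rewrite -(qcoset_repr a) -(qcoset_repr b).
  rewrite ![f x _]descendE => ab.
  by apply/qcoset_eqP/conn_eq0; rewrite linearB ab subrr.
- move=> b; split=> [|[a <-]].
    rewrite -(qcoset_repr b) gE => /incl_class_eq0[d dv]; set v := repr b in dv *.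
    have d0 : rho0 x (alpha x d) = 0 by rewrite -comm dv; exact: (sublmodP (subval v)).
    pose u : subfam (ker rho0) x := SubLmod (introT (subpredP (ker rho0 x) _) d0).
    exists (qcoset _ u); rewrite (@fE x u d) //; congr qcoset.
    by do 2 apply: val_inj; rewrite -[RHS]dv; exact: cocycleE.
  rewrite -(qcoset_repr a); set v := repr a.
  have [d dv] := alpha_surj (subval v).
  rewrite (fE _ _ _ dv) gE; apply/incl_class_eq0; exists d.
  by rewrite cocycleE // dv; exact: (sublmodP v).
- move=> c; rewrite -(qcoset_repr c); set w := repr c.
  have [c0 c0w] := Z_rho0 (sublmodP w); have [d dc0] := alpha_surj c0.
  have vK : ker beta x (subval w - rho1 x d).
    by rewrite /= linearB comm dc0 c0w subrr.
  pose u : sublmod (ker beta x) := SubLmod (introT (subpredP (ker beta x) _) vK).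
  have uS : S x u.
    apply/SE; rewrite /= addrC -scaleN1r; apply: subspace_lin; first exact: rho1_Z.
    exact: sublmodP.
  (* w and its correction w - rho1 d have the same class modulo im rho1. *)
  exists (qcoset _ (SubLmod (introT (subpredP (S x) _) uS) : subfam S x)).
  rewrite gE; apply/qcoset_eqP; exists (- d) => //.
  by rewrite linearN linearB /= addrC addKr.
Qed.
End Snake.
End BundleMaps.

(** * The square of jet spaces *)

Section Jets.
Context {R : realType} {n : nat} {M : manifold R n}.

Lemma jet_pi_surj (E : vfamily M) k l (kl : (k <= l)%N) x (c : Jet E k x) :
  exists d, jet_pi E kl x d = c.
Proof. by have [s xs <-] := jet_surj c; exists (jet l s x); rewrite jet_piE. Qed.

(** The order of the jets in a local expression by the j_k(s_i) can be raised from
    k to l without changing the coefficients or the s_i. *)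
Lemma jet_pi_lift (E : vfamily M) k l (kl : (k <= l)%N) p (t : section (Jet E k)) :
  smooth_at p t -> exists2 t' : section (Jet E l),
    smooth_at p t' & \forall x \near p, jet_pi E kl x (t' x) = t x.
Proof.
move=> [m [f [s [pf ps ts]]]].
exists (fun x => \sum_i f i x *: jet l (s i) x).
  by apply: smooth_sum => i; apply: smoothZ => //; exact: smooth_jet.
have near_s : \forall x \near p, forall i, smooth_at x (s i).
  by apply: filter_forall => i; exact: smooth_near.
apply: filterS2 ts near_s => x -> xs; rewrite linear_sum; apply: eq_bigr => i _.
by rewrite linearZ; congr (_ *: _); exact: jet_piE.
Qed.

(** Exactness at J_r(F) of rho_r(Phi) followed by Psi_r, combined with the fact that
    a section whose 1-jet vanishes at x vanishes at x. *)
Lemma ker_prolong_Psi (q : nat) (E F : vfamily M) (Phi : bundle_map (Jet E q) F) r x w :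
  ker (prolong (Psi Phi r) 1) x w ->
  exists c, prolong Phi r x c = jet_pi F (leqnSn r) x w.
Proof.
have [s xs <-] := jet_surj w => w0.
have xPs : smooth_at x (fun y => Psi Phi r y (jet r s y)) by exact/hom_smooth/smooth_jet.
have := etrans (esym (prolongE (Psi Phi r) 1 xs)) w0.
move=> /(jet_eq0 1 xPs)/vanish_at/qcoset_eq0[c _ cs].
exists c; exact: etrans cs (esym (jet_piE _ xs)).
Qed.

Section Cochains.
Variables (q : nat) (E F : vfamily M) (Phi : bundle_map (Jet E q) F) (r : nat).

(** [Rproj] is defined with the projection attached to another proof of the
    inequality between jet orders. *)
Lemma Rproj1P x c : Rproj Phi r 1 x c <->
  exists2 d, prolong Phi r.+1 x d = 0 & jet_pi E (leqnSn (r + q)) x d = c.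
Proof.
have piE d : jet_pi E (leq_add (leq_addl 1 r) (leqnn q)) x d =
             jet_pi E (leqnSn (r + q)) x d.
  have [s xs <-] := jet_surj d.
  exact: etrans (jet_piE _ xs) (esym (jet_piE _ xs)).
by split=> [][d d0 <-]; exists d => //; rewrite piE.
Qed.

Lemma ker_symbol_PsiP x (v : symT F r x) :
  ker (symbol (Psi Phi r) 0) x v <-> ker (prolong (Psi Phi r) 1) x (subval v).
Proof.
split=> [v0|v0]; last by apply: val_inj.
by rewrite /= -[LHS]/(subval (symbol (Psi Phi r) 0 x v)) v0.
Qed.

Lemma im_symbolP x (v : symT F r x) : im (symbol Phi r) x v <->
  exists2 d, jet_pi E (leqnSn (r + q)) x d = 0 & prolong Phi r.+1 x d = subval v.
Proof.
split=> [[d _ <-]|[d d0 dv]]; first by exists (subval d) => //; exact: (sublmodP d).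
exists (SubLmod (introT (subpredP (ker (jet_pi E (leqnSn (r + q))) x) _) d0)) => //.
exact: val_inj.
Qed.
End Cochains.
End Jets.

Theorem proposition3p2 (R : realType) (n : nat) (X : manifold R n)
    (E F0 : vfamily X) (q : nat) (Phi : bundle_map (Jet E q) F0) :
  vector_bundle E -> vector_bundle F0 ->
  (forall r, vector_bundle (subfam (Rker Phi r))) ->
  (forall r s, vector_bundle (subfam (Rproj Phi r s))) ->
  forall r, exists (f : bundle_map (HR Phi r) (HS Phi r))
    (g : bundle_map (HS Phi r) (HJ Phi r)), short_exact f g.
Proof.
move=> _ _ _ _ r.
exact: (snake_short_exact (Z := ker (prolong (Psi Phi r) 1))
  (prolong_pi Phi (r := r))
  (jet_pi_surj (leqnSn (r + q))) (jet_pi_lift (leqnSn (r + q)))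
  (@prolong_Psi0 _ _ _ _ _ _ Phi r) (@ker_prolong_Psi _ _ _ _ _ _ Phi r)
  (@Rproj1P _ _ _ _ _ _ Phi r) (@ker_symbol_PsiP _ _ _ _ _ _ Phi r)
  (@im_symbolP _ _ _ _ _ _ Phi r)).
Qed.
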